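(* Let $A=\{z\in\mathbb{C}: r_1<|z|<r_2\}$ with $r_1<r_2$ be an annulus, and let $X=(k,h):A\to\mathbb{C}\times\mathbb{R}\equiv\mathbb{R}^3$ be a non-planar rotational harmonic Enneper immersion, in the normalized coordinate described in the context. Then there exist $a,b\in\mathbb{C}$ and a real number $c>0$ such that, in polar coordinates $(r,\theta)$ on $A$ (i.e. $z=re^{i\theta}$), $$X(r,\theta)=\frac1c\left(e^{i\theta}\Bigl(ar+\frac br\Bigr),\ \ln r\right).$$
   Context: $\mathbb{R}^3$ is identified with $\mathbb{C}\times\mathbb{R}$ via $(X_1,X_2,X_3)\mapsto(X_1+iX_2,X_3)$. The operator $\partial_z:=\frac{\partial}{\partial x}-i\frac{\partial}{\partial y}$ is normalized without the factor $1/2$, and a subscript $z$ denotes its application. A harmonic immersion is an immersion whose coordinate functions are harmonic. A harmonic Enneper immersion is a harmonic immersion of the form $X=(L+\overline P,h)$ with $h$ real harmonic and $L,P$ holomorphic (on $A$, which is not simply connected, $L$ and $P$ are understood locally, so that $k=L+\overline P$ is a complex-valued harmonic function on $A$), with $|L_z|\neq|P_z|$. Rotational means that the image $X(A)$ is invariant under all rotations about the vertical axis $\{0\}\times\mathbb{R}$. The coordinate $z$ on $A$ is normalized as follows: the conjugate harmonic function $h^*$ of $h$ has non-zero additive period $m$ around $A$, and $z=e^{(h+ih^* )2\pi/m}$, so that $h$ is a positive constant multiple of $\ln|z|$; moreover (up to a symmetry with respect to a vertical plane) the rotations of $X(A)$ induce the biholomorphisms $z\mapsto e^{i\theta}z$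 of $A$, so that $k(e^{i\theta}z)=e^{i\theta}k(z)$ for all $z\in A$ and $\theta\in\mathbb{R}$. *)

(* Defs.v *)
From Stdlib Require Import Reals.
From Coquelicot Require Import Coquelicot.
Open Scope R_scope.

Definition cis (t : R) : C := (cos t, sin t).
Definition Cexp (w : C) : C := Cmult (RtoC (exp (Re w))) (cis (Im w)).

(* The annulus r1 < |z| < r2; the value r2 = p_infty is allowed. *)
Definition annulus (r1 : R) (r2 : Rbar) (z : C) : Prop :=
  r1 < Cmod z /\ Rbar_lt (Finite (Cmod z)) r2.

(* Functions are total; all the notions below are used on open sets D of the
   plane, where they only depend on the values of the functions on D. *)

Definition pdx (u : C -> R) (z : C) : R := Derive (fun x => u (x, Im z)) (Re z).
Definition pdy (u : C -> R) (z : C) : R := Derive (fun y => u (Re z, y)) (Im z).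

Definition C1_on (D : C -> Prop) (u : C -> R) : Prop :=
  forall z : C, D z ->
    ex_derive (fun x => u (x, Im z)) (Re z) /\
    ex_derive (fun y => u (Re z, y)) (Im z) /\
    continuous (T := C_UniformSpace) (U := R_UniformSpace) (pdx u) z /\
    continuous (T := C_UniformSpace) (U := R_UniformSpace) (pdy u) z.

Definition C2_on (D : C -> Prop) (u : C -> R) : Prop :=
  C1_on D u /\ C1_on D (pdx u) /\ C1_on D (pdy u).

Definition harmonic_on (D : C -> Prop) (u : C -> R) : Prop :=
  C2_on D u /\ forall z : C, D z -> pdx (pdx u) z + pdy (pdy u) z = 0.

Definition holomorphic_on (D : C -> Prop) (f : C -> C) : Prop :=
  forall z : C, D z -> ex_derive (K := C_AbsRing) (V := C_NormedModule) f z.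

(* v is a conjugate harmonic function of u *)
Definition harmonic_conjugate_on (D : C -> Prop) (u v : C -> R) : Prop :=
  holomorphic_on D (fun z => (u z, v z)).

Definition re_part (f : C -> C) (z : C) : R := Re (f z).
Definition im_part (f : C -> C) (z : C) : R := Im (f z).

(* d/dx - i d/dy, without the factor 1/2 *)
Definition dz (f : C -> C) (z : C) : C :=
  Cminus (pdx (re_part f) z, pdx (im_part f) z)
         (Cmult Ci (pdy (re_part f) z, pdy (im_part f) z)).

(* R^3 is C * R. *)
Definition kpart (X : C -> C * R) (z : C) : C := fst (X z).
Definition hpart (X : C -> C * R) (z : C) : R := snd (X z).

Definition immersion_on (D : C -> Prop) (X : C -> C * R) : Prop :=
  C1_on D (re_part (kpart X)) /\
  C1_on D (im_part (kpart X)) /\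
  C1_on D (hpart X) /\
  forall z : C, D z -> forall s t : R,
    s * pdx (re_part (kpart X)) z + t * pdy (re_part (kpart X)) z = 0 ->
    s * pdx (im_part (kpart X)) z + t * pdy (im_part (kpart X)) z = 0 ->
    s * pdx (hpart X) z + t * pdy (hpart X) z = 0 ->
    s = 0 /\ t = 0.

Definition harmonic_immersion_on (D : C -> Prop) (X : C -> C * R) : Prop :=
  immersion_on D X /\
  harmonic_on D (re_part (kpart X)) /\
  harmonic_on D (im_part (kpart X)) /\
  harmonic_on D (hpart X).

(* L and P exist only locally, since D need not be simply connected. *)
Definition harmonic_Enneper_immersion_on (D : C -> Prop) (X : C -> C * R) : Prop :=
  harmonic_immersion_on D X /\
  forall z0 : C, D z0 -> exists (U : C -> Prop) (L P : C -> C),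
    open (T := C_UniformSpace) U /\ U z0 /\ (forall z, U z -> D z) /\
    holomorphic_on U L /\ holomorphic_on U P /\
    forall z : C, U z ->
      kpart X z = Cplus (L z) (Cconj (P z)) /\
      Cmod (dz L z) <> Cmod (dz P z).

Definition planar_on (D : C -> Prop) (X : C -> C * R) : Prop :=
  exists n1 n2 n3 d : R,
    (n1 <> 0 \/ n2 <> 0 \/ n3 <> 0) /\
    forall z : C, D z ->
      n1 * Re (kpart X z) + n2 * Im (kpart X z) + n3 * hpart X z = d.

Definition image (D : C -> Prop) (X : C -> C * R) (p : C * R) : Prop :=
  exists z : C, D z /\ X z = p.

Definition rotation (t : R) (p : C * R) : C * R := (Cmult (cis t) (fst p), snd p).

Definition rotational_on (D : C -> Prop) (X : C -> C * R) : Prop :=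
  forall (t : R) (p : C * R), image D X p -> image D X (rotation t p).

(* Around an annulus D, the conjugate function h* of h is multivalued.  It is
   taken on the universal cover { w | Cexp w in D } of D, on which going once
   around D is the translation w -> w + 2 i pi; the equation
   z = exp ((h + i h* ) 2 pi / m) is stated at z = Cexp w.  Its modulus gives
   h = (m / (2 pi)) ln |z|, so h is a positive multiple of ln |z| iff m > 0. *)
Definition normalized_coordinate_on (D : C -> Prop) (X : C -> C * R) : Prop :=
  (exists (m : R) (hstar : C -> R),
     0 < m /\
     harmonic_conjugate_on (fun w => D (Cexp w))
       (fun w => hpart X (Cexp w)) hstar /\
     (forall w : C, D (Cexp w) ->
        hstar (Cplus w (0, 2 * PI)) = hstar w + m) /\
     (forall w : C, D (Cexp w) ->
        Cexp w = Cexp (Cmult (hpart X (Cexp w), hstar w) (RtoC (2 * PI / m))))) /\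
  (forall (t : R) (z : C), D z ->
     kpart X (Cmult (cis t) z) = Cmult (cis t) (kpart X z)).

(* Main.v *)
(* By equivariance the horizontal part is e^{i theta} f(r) with f(r) = k(r), so
   k is determined by its restriction to the positive real axis, where its
   Laplacian is f'' + f'/r - f/r^2 = (f' + f/r)'.  Hence f' + f/r is a constant
   2a, that is (r f - a r^2)' = 0, and f = a r + b/r.  The height is read off
   the modulus of z = exp((h + i h* ) 2 pi / m). *)
Require Import Defs.
From Stdlib Require Import Reals Lra.
From Coquelicot Require Import Coquelicot.
Open Scope R_scope.

Lemma polar_angle (x y : R) :
  0 < Cmod (x, y) ->
  exists t : R, cos t = x / Cmod (x, y) /\ sin t = y / Cmod (x, y).
Proof.
intros hp.
assert (hq : Cmod (x, y) * Cmod (x, y) = x * x + y * y).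
{ unfold Cmod; simpl fst; simpl snd; rewrite sqrt_sqrt; nra. }
set (p := Cmod (x, y)) in *.
assert (hxy : Rsqr (x / p) + Rsqr (y / p) = 1).
{ unfold Rsqr; field_simplify; [|lra].
  replace (x ^ 2 + y ^ 2) with (p ^ 2) by nra. field; lra. }
assert (hb : -1 <= x / p <= 1).
{ unfold Rsqr in hxy; nra. }
assert (hs : sin (acos (x / p)) = Rabs (y / p)).
{ rewrite sin_acos by exact hb.
  replace (1 - Rsqr (x / p)) with (Rsqr (y / p)) by lra.
  apply sqrt_Rsqr_abs. }
(* [acos] only returns angles with non-negative sine, so points below the real axis take the
   opposite angle. *)
destruct (Rle_lt_dec 0 (y / p)) as [h|h].
- exists (acos (x / p)); split; [apply cos_acos; exact hb|].
  rewrite hs; apply Rabs_pos_eq; exact h.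
- exists (- acos (x / p)); split; [rewrite cos_neg; apply cos_acos; exact hb|].
  rewrite sin_neg, hs, Rabs_left by exact h; ring.
Qed.

Lemma Cmod_RtoC_pos (r : R) : 0 < r -> Cmod (r, 0) = r.
Proof.
intros h; change (Cmod (RtoC r) = r); rewrite Cmod_R; apply Rabs_pos_eq; lra.
Qed.

Lemma Cmod_cis (t : R) : Cmod (cis t) = 1.
Proof.
unfold Cmod, cis; simpl fst; simpl snd.
replace (cos t ^ 2 + sin t ^ 2) with 1; [apply sqrt_1|].
generalize (sin2_cos2 t); unfold Rsqr; lra.
Qed.

Lemma Cmod_Cexp (w : C) : Cmod (Cexp w) = exp (Re w).
Proof.
unfold Cexp; rewrite Cmod_mult, Cmod_cis, Cmod_R, Rabs_pos_eq; [ring|].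
apply Rlt_le, exp_pos.
Qed.

(** Closed formulas for [u] and [pdy u] are known only inside the annulus; this lets them be
    differentiated in [y]. It rests on continuity of the modulus along the vertical line, away from
    the origin. *)
Lemma annulus_vertical_locally (r1 : R) (r2 : Rbar) (x y : R) :
  annulus r1 r2 (x, y) -> 0 < Cmod (x, y) ->
  locally y (fun y' => annulus r1 r2 (x, y')).
Proof.
intros [h1 h2] hp.
assert (hc : continuous (fun y' : R => Cmod (x, y')) y).
{ apply (ex_derive_continuous (K := R_AbsRing) (V := R_NormedModule)).
  unfold Cmod in *; simpl in *; auto_derive.
  (* [sqrt] is 0 on non-positive reals, so a positive modulus forces a positive radicand. *)
  apply Rnot_le_lt; intros hn; rewrite sqrt_neg_0 in hp; lra. }
apply filter_and.
- exact (hc _ (open_gt r1 _ h1)).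
- apply (hc (fun q => Rbar_lt (Finite q) r2)).
  destruct r2 as [q| |]; simpl in *.
  + exact (open_lt q _ h2).
  + apply filter_forall; trivial.
  + contradiction.
Qed.

Lemma is_derive_zero_const (r1 : R) (r2 : Rbar) (f : R -> R) :
  (forall r, r1 < r -> Rbar_lt (Finite r) r2 -> is_derive f r 0) ->
  forall s t, r1 < s -> Rbar_lt (Finite s) r2 ->
    r1 < t -> Rbar_lt (Finite t) r2 -> f s = f t.
Proof.
intros hf.
assert (H : forall s t, r1 < s -> Rbar_lt (Finite t) r2 -> s < t -> f s = f t).
{ intros s t hs ht hst.
  apply (eq_is_derive (V := R_NormedModule)); [|exact hst].
  intros q hq; apply hf; [lra|].
  apply Rbar_le_lt_trans with (2 := ht); simpl; lra. }
intros s t hs1 hs2 ht1 ht2.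
destruct (Rtotal_order s t) as [h|[h|h]].
- apply H; assumption.
- now subst.
- symmetry; apply H; assumption.
Qed.

Lemma interval_inhabited (r1 : R) (r2 : Rbar) :
  Rbar_lt (Finite r1) r2 -> exists r, r1 < r /\ Rbar_lt (Finite r) r2.
Proof.
destruct r2 as [q| |]; simpl; intros h.
- exists ((r1 + q) / 2); lra.
- exists (r1 + 1); split; [lra|trivial].
- contradiction.
Qed.

(** Two successive first integrals replace a uniqueness theorem for this Euler equation with
    exponents 1 and -1. *)
Lemma Euler_ode (r1 : R) (r2 : Rbar) (f f' f'' : R -> R) :
  0 <= r1 -> Rbar_lt (Finite r1) r2 ->
  (forall r, r1 < r -> Rbar_lt (Finite r) r2 ->
     is_derive f r (f' r) /\ is_derive f' r (f'' r) /\
     f'' r + (f' r / r - f r / r ^ 2) = 0) ->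
  exists a b : R, forall r, r1 < r -> Rbar_lt (Finite r) r2 ->
    f r = a * r + b / r.
Proof.
intros h0 h12 hf.
destruct (interval_inhabited r1 r2 h12) as [r0 [hr1 hr2]].
(* Half the first integral, read off at the base point [r0]. *)
set (a := (f' r0 + f r0 / r0) / 2).
assert (A : forall r, r1 < r -> Rbar_lt (Finite r) r2 -> f' r + f r / r = 2 * a).
{ intros r h1 h2.
  replace (2 * a) with (f' r0 + f r0 / r0) by (unfold a; field; lra).
  apply (is_derive_zero_const r1 r2 (fun r => f' r + f r / r)); trivial.
  clear r h1 h2; intros r h1 h2.
  destruct (hf r h1 h2) as [d1 [d2 e]].
  evar_last.
  { apply (is_derive_plus (V := R_NormedModule)); [exact d2|].
    apply is_derive_div; [exact d1|apply (is_derive_id (K := R_AbsRing))|lra]. }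
  rewrite <- e. unfold plus, one; simpl; field; lra. }
(* The second integral [r f - a r^2] at [r0] is [b]; its derivative is [r (f' + f / r - 2 a)], which
   vanishes by [A]. *)
exists a, (r0 * f r0 - a * r0 ^ 2); intros r h1 h2.
assert (B : r * f r - a * r ^ 2 = r0 * f r0 - a * r0 ^ 2).
{ apply (is_derive_zero_const r1 r2 (fun r => r * f r - a * r ^ 2)); trivial.
  clear r h1 h2; intros r h1 h2.
  destruct (hf r h1 h2) as [d1 _].
  auto_derive; [exists (f' r); exact d1|].
  rewrite (is_derive_unique (fun q : R => f q) r _ d1).
  generalize (A r h1 h2); intros e.
  replace (f' r) with (2 * a - f r / r) by lra.
  field; lra. }
rewrite <- B; field; lra.
Qed.

(** The sign [s] treats both components of [k] at once: -1 when [u] is the real part, 1 when it is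
    the imaginary part. On the positive axis [u_yy] equals [f' / r - f / r^2]; the term in [v] is
    odd in [y], so it contributes nothing there. *)
Lemma radial_laplacian (r1 : R) (r2 : Rbar) (u v : C -> R) (s r : R) :
  0 <= r1 -> harmonic_on (annulus r1 r2) u -> harmonic_on (annulus r1 r2) v ->
  (forall x y, annulus r1 r2 (x, y) ->
     u (x, y) = (x * u (Cmod (x, y), 0) + s * y * v (Cmod (x, y), 0)) / Cmod (x, y)) ->
  r1 < r -> Rbar_lt (Finite r) r2 ->
  pdx (pdx u) (r, 0) + (pdx u (r, 0) / r - u (r, 0) / r ^ 2) = 0.
Proof.
intros h0 hu hv huv hr1 hr2.
assert (hax : forall q, r1 < q -> Rbar_lt (Finite q) r2 -> annulus r1 r2 (q, 0)).
{ intros q h1 h2; unfold annulus; rewrite Cmod_RtoC_pos by lra; now split. }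
destruct hu as [[hu1 [hu2 _]] hlap], hv as [[hv1 [hv2 _]] _].
apply (eq_trans (y := pdx (pdx u) (r, 0) + pdy (pdy u) (r, 0)));
  [f_equal|exact (hlap (r, 0) (hax r hr1 hr2))].
set (f := fun q : R => u (q, 0)); set (f' := fun q : R => pdx u (q, 0)).
set (g := fun q : R => v (q, 0)); set (g' := fun q : R => pdx v (q, 0)).
assert (df : forall q, r1 < q -> Rbar_lt (Finite q) r2 -> is_derive f q (f' q)).
{ intros q h1 h2; apply Derive_correct, (hu1 (q, 0) (hax q h1 h2)). }
assert (dg : forall q, r1 < q -> Rbar_lt (Finite q) r2 -> is_derive g q (g' q)).
{ intros q h1 h2; apply Derive_correct, (hv1 (q, 0) (hax q h1 h2)). }
assert (df' : ex_derive f' r) by apply (hu2 (r, 0) (hax r hr1 hr2)).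
assert (dg' : ex_derive g' r) by apply (hv2 (r, 0) (hax r hr1 hr2)).
(* The modulus along the vertical line through [(r, 0)]. *)
set (p := fun y : R => sqrt (r ^ 2 + y ^ 2)).
assert (hp0 : p 0 = r).
{ unfold p; replace (r ^ 2 + 0 ^ 2) with (r ^ 2) by ring; apply sqrt_pow2; lra. }
assert (hpos : forall y, 0 < p y).
{ intros y; apply sqrt_lt_R0; nra. }
assert (dp : forall y, is_derive p y (y / p y)).
{ intros y; unfold p; auto_derive; [nra|].
  replace (r * (r * 1) + y * (y * 1)) with (r ^ 2 + y ^ 2) by ring.
  field; apply Rgt_not_eq, (hpos y). }
(* The derivative in [y] of [(r f(p) + s y g(p)) / p]. A formula valid near [y = 0], not just at 0,
   is needed in order to differentiate again. *)
set (W := fun y : R =>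
  r * (f' (p y) * (y / p y)) / p y + s * g (p y) / p y
  + s * y * (g' (p y) * (y / p y)) / p y
  - (r * f (p y) + s * y * g (p y)) * (y / p y) / (p y) ^ 2).
assert (dW : forall y, annulus r1 r2 (r, y) -> pdy u (r, y) = W y).
{ intros y hy; unfold pdy; simpl Re; simpl Im.
  apply is_derive_unique.
  apply (is_derive_ext_loc
    (fun y => (r * f (p y) + s * y * g (p y)) / p y)).
  - apply (filter_imp (fun y' => annulus r1 r2 (r, y'))).
    + intros t ht; symmetry; exact (huv r t ht).
    + apply annulus_vertical_locally; [exact hy|exact (hpos y)].
  - destruct hy as [hy1 hy2].
    assert (e1 := df (p y) hy1 hy2); assert (e2 := dg (p y) hy1 hy2).
    assert (hq := hpos y).
    auto_derive.
    + repeat split; try (exists (y / p y); apply dp); try lra.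
      * exists (f' (p y)); exact e1.
      * exists (g' (p y)); exact e2.
    + rewrite (is_derive_unique (fun q : R => f q) _ _ e1),
        (is_derive_unique (fun q : R => g q) _ _ e2),
        (is_derive_unique (fun q : R => p q) _ _ (dp y)).
      unfold W; field; lra. }
unfold pdy at 1; simpl Re; simpl Im; symmetry.
rewrite (Derive_ext_loc _ W).
- apply is_derive_unique; unfold W.
  assert (e1 := df r hr1 hr2); assert (e2 := dg r hr1 hr2).
  auto_derive.
  + rewrite hp0; repeat split; trivial; try (exists (0 / p 0); apply dp);
      try lra; try (now exists (f' r)); try (now exists (g' r)).
    all: try (apply Rgt_not_eq; nra).
  (* Since [p' = 0] at [y = 0], the derivatives of [f'] and [g'] get a zero factor: their existence
     suffices, not their values. *)
  + rewrite (is_derive_unique (fun q : R => p q) _ _ (dp 0)), hp0.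
    fold (f' r); change (u (r, 0)) with (f r).
    field; lra.
- apply (filter_imp (fun y => annulus r1 r2 (r, y))); [exact dW|].
  apply annulus_vertical_locally; [exact (hax r hr1 hr2)|].
  rewrite Cmod_RtoC_pos; lra.
Qed.

Lemma radial_profile (r1 : R) (r2 : Rbar) (u v : C -> R) (s : R) :
  0 <= r1 -> Rbar_lt (Finite r1) r2 ->
  harmonic_on (annulus r1 r2) u -> harmonic_on (annulus r1 r2) v ->
  (forall x y, annulus r1 r2 (x, y) ->
     u (x, y) = (x * u (Cmod (x, y), 0) + s * y * v (Cmod (x, y), 0)) / Cmod (x, y)) ->
  exists a b : R, forall r, r1 < r -> Rbar_lt (Finite r) r2 ->
    u (r, 0) = a * r + b / r.
Proof.
intros h0 h12 hu hv huv.
apply (Euler_ode r1 r2 (fun r => u (r, 0)) (fun r => pdx u (r, 0))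
  (fun r => pdx (pdx u) (r, 0))); trivial.
intros r hr1 hr2.
assert (hD : annulus r1 r2 (r, 0)).
{ unfold annulus; rewrite Cmod_RtoC_pos by lra; now split. }
destruct (proj1 hu) as [hu1 [hu2 _]].
split; [|split].
- apply Derive_correct, (hu1 (r, 0) hD).
- apply Derive_correct, (hu2 (r, 0) hD).
- now apply (radial_laplacian r1 r2 u v s).
Qed.

(** The point is its modulus rotated by its argument. Writing the rotation as [(x + iy) / |z|]
    removes the angle, so that the formula can be differentiated without choosing a branch of the
    argument. *)
Lemma equivariant_polar (r1 : R) (r2 : Rbar) (k : C -> C) (x y : R) :
  0 <= r1 ->
  (forall (t : R) (z : C), annulus r1 r2 z ->
     k (Cmult (cis t) z) = Cmult (cis t) (k z)) ->
  annulus r1 r2 (x, y) ->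
  k (x, y) = Cmult (x / Cmod (x, y), y / Cmod (x, y)) (k (Cmod (x, y), 0)).
Proof.
intros h0 hk hz.
assert (hp : 0 < Cmod (x, y)) by (destruct hz; lra).
destruct (polar_angle x y hp) as [t [hc hs]].
rewrite <- hc, <- hs; fold (cis t); rewrite <- hk.
- f_equal; unfold cis, Cmult; simpl fst; simpl snd; rewrite hc, hs.
  f_equal; field; lra.
- unfold annulus in *; rewrite Cmod_RtoC_pos by exact hp; exact hz.
Qed.

Theorem proposition4p2 (r1 : R) (r2 : Rbar) (X : C -> C * R)
  (hr1 : 0 <= r1) (hr12 : Rbar_lt (Finite r1) r2)
  (hX : harmonic_Enneper_immersion_on (annulus r1 r2) X)
  (hplanar : ~ planar_on (annulus r1 r2) X)
  (hrot : rotational_on (annulus r1 r2) X)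
  (hnorm : normalized_coordinate_on (annulus r1 r2) X) :
  exists (a b : C) (c : R), 0 < c /\
    forall r theta : R, r1 < r -> Rbar_lt (Finite r) r2 ->
      X (Cmult (RtoC r) (cis theta)) =
        (Cmult (RtoC (1 / c))
           (Cmult (cis theta) (Cplus (Cmult a (RtoC r)) (Cdiv b (RtoC r)))),
         1 / c * ln r).
Proof.
destruct hX as [[_ [hu [hv _]]] _].
destruct hnorm as [[m [hstar [hm [_ [_ hexp]]]]] hk].
assert (hpi := PI_RGT_0).
set (u := re_part (kpart X)) in *; set (v := im_part (kpart X)) in *.
(* The real part of [(x + iy)(u + iv)] is [x u - y v], hence the sign -1; below, the imaginary part
   [x v + y u] gives 1 with the roles exchanged. *)
destruct (radial_profile r1 r2 u v (-1)) as [a1 [b1 h1]]; trivial.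
{ intros x y hz; unfold u, v, re_part, im_part.
  assert (0 < Cmod (x, y)) by (destruct hz; lra).
  rewrite (equivariant_polar r1 r2 _ x y hr1 hk hz) at 1.
  unfold Cmult, Re, Im; simpl fst; field; lra. }
destruct (radial_profile r1 r2 v u 1) as [a2 [b2 h2]]; trivial.
{ intros x y hz; unfold u, v, re_part, im_part.
  assert (0 < Cmod (x, y)) by (destruct hz; lra).
  rewrite (equivariant_polar r1 r2 _ x y hr1 hk hz) at 1.
  unfold Cmult, Re, Im; simpl snd; field; lra. }
(* Chosen so that [h = (1 / c) ln |z|]; the horizontal coefficients are then scaled by [c] to cancel
   the common factor [1 / c]. *)
set (c := 2 * PI / m).
assert (hc : 0 < c) by (apply Rdiv_lt_0_compat; lra).
exists (c * a1, c * a2), (c * b1, c * b2), c; split; [exact hc|].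
intros r theta hr hr'.
assert (hD : annulus r1 r2 (r, 0)).
{ unfold annulus; rewrite Cmod_RtoC_pos by lra; now split. }
rewrite (surjective_pairing (X _)); f_equal.
- fold (kpart X (Cmult (RtoC r) (cis theta))).
  rewrite Cmult_comm, (hk theta (RtoC r) hD).
  replace (kpart X (RtoC r)) with (u (r, 0), v (r, 0))
    by (symmetry; apply surjective_pairing).
  rewrite h1, h2 by assumption.
  assert (hrC : RtoC r <> RtoC 0) by (intros e; injection e; lra).
  rewrite Cmult_assoc, (Cmult_comm (RtoC (1 / c))), <- Cmult_assoc; f_equal.
  unfold Cdiv; rewrite <- RtoC_inv by lra.
  unfold Cmult, Cplus, RtoC; simpl; f_equal; field; lra.
- fold (hpart X (Cmult (RtoC r) (cis theta))).
  (* Lift the point to [ln r + i theta] in the universal cover. Taking moduli in [hexp] there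
     eliminates [hstar] and leaves [ln r = c h]. *)
  assert (hw : Cexp (ln r, theta) = Cmult (RtoC r) (cis theta)).
  { unfold Cexp; simpl Re; simpl Im; rewrite exp_ln by lra; reflexivity. }
  assert (hDw : annulus r1 r2 (Cexp (ln r, theta))).
  { unfold annulus; rewrite Cmod_Cexp; simpl Re; rewrite exp_ln by lra; now split. }
  assert (e := f_equal Cmod (hexp _ hDw)).
  rewrite !Cmod_Cexp in e; apply exp_inv in e; rewrite hw in e.
  fold c in e; simpl in e; rewrite e; field; lra.
Qed.
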